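(* Let $D\in\mathbb{N}$ be a positive non-square discriminant and let $k\in\mathbb{N}$ be even. The modular transformation behavior of $P_{g_{k+1,D}}$ is given by $$P_{g_{k+1,D}}(\tau+1)=P_{g_{k+1,D}}(\tau)\qquad\text{and}\qquad P_{g_{k+1,D}}\left(\frac{-1}{\tau}\right)=\tau^{2k+2}\left(P_{g_{k+1,D}}(\tau)-q_{k+1,D}(\tau)\right)$$ for $\tau\in\mathbb{H}$. Moreover, the function $x\mapsto\lim_{\tau\to x}P_{g_{k+1,D}}(\tau)$ for $x\in\mathbb{Q}$ is a weak quantum modular form of weight $2k+2$ with Haupttypus (trivial multiplier) for the whole modular group $\mathrm{SL}_2(\mathbb{Z})$.
   Context: $\mathbb{H}=\{\tau=u+iv\in\mathbb{C}:v>0\}$ and $\Gamma=\mathrm{SL}_2(\mathbb{Z})$. $\mathcal{Q}_D$ is the set of all binary integral quadratic forms $Q=[a,b,c]$, $Q(X,Y)=aX^2+bXY+cY^2$, with $a,b,c\in\mathbb{Z}$ and discriminant $b^2-4ac=D$. Put $\operatorname{sgn}([a,b,c])=\operatorname{sgn}(a)$ if $a\neq0$ and $\operatorname{sgn}([a,b,c])=\operatorname{sgn}(c)$ if $a=0$; $Q_\tau=\frac{a|\tau|^2+bu+c}{v}$; and $S_Q=\{\tau\in\mathbb{H}:Q_\tau=0\}$, a semicircle connecting the two real roots of $Q(\tau,1)$. Define $$P_{g_{k+1,D}}(\tau)=\sum_{Q\in\mathcal{Q}_D}\frac{\operatorname{sgn}(Q)\mathbf{1}_Q(\tau)}{Q(\tau,1)^{k+1}}=2\sum_{\substack{Q=[a,b,c]\in\mathcal{Q}_D\\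 a>0}}\frac{\mathbf{1}_Q(\tau)}{Q(\tau,1)^{k+1}},$$ where $\mathbf{1}_Q$ is the indicator function of the bounded area described by $S_Q$ and the real line. Define also the finite sum $$q_{k+1,D}(\tau)=\sum_{\substack{Q=[a,b,c]\in\mathcal{Q}_D\\ b^2<D}}\frac{\operatorname{sgn}(Q)}{Q(\tau,1)^{k+1}}.$$ For $x\in\mathbb{Q}$ the limit is $$\lim_{\tau\to x}P_{g_{k+1,D}}(\tau)=-2\sum_{\substack{Q=[a,b,c]\in\mathcal{Q}_D\\ a<0<Q(x,1)}}\frac{1}{Q(x,1)^{k+1}}.$$ A function $f:\mathbb{Q}\to\mathbb{C}$ is a weak quantum modular form of weight $r$ with Haupttypus for $\Gamma$ if for every $\gamma=\begin{pmatrix}a_1&a_2\\ a_3&a_4\end{pmatrix}\in\Gamma$ the function $h_\gamma(x)=f(x)-(a_3x+a_4)^{-r}f(\gamma x)$, where $\gamma x=\frac{a_1x+a_2}{a_3x+a_4}$, can be continued to a real analytic function on $\mathbb{R}\setminus S_\gamma$, where $S_\gamma$ is a finite subset of $\mathbb{R}$.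
   Formalization: The inversion law is stated on all of H if 1_Q has value 1/2 on S_Q, otherwise only for τ off the arcs S_Q with b²<D, where it fails for a 0/1 indicator; the limit τ→x is taken within sectors |u−x| ≤ Mv, since P is unbounded near every x and the unrestricted limit does not exist. *)

(* Defs.v *)
From HB Require Import structures.
From mathcomp Require Import all_boot all_order all_algebra.
From mathcomp Require Import all_classical all_reals all_analysis.
From mathcomp Require Import complex.

Set Implicit Arguments.
Unset Strict Implicit.
Unset Printing Implicit Defensive.

Import Order.TTheory GRing.Theory Num.Theory.
Import numFieldNormedType.Exports.
Import complex.

Local Open Scope classical_set_scope.
Local Open Scope ring_scope.
Local Open Scope complex_scope.

Definition upper_half_plane {R : realType} : set R[i] := [set tau | 0 < Im tau].

(* [((a, b), c)] encodes the form [a, b, c] = a X^2 + b X Y + c Y^2. *)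
Definition qform := (int * int * int)%type.
Definition qfa (Q : qform) : int := Q.1.1.
Definition qfb (Q : qform) : int := Q.1.2.
Definition qfc (Q : qform) : int := Q.2.

Definition qdisc (Q : qform) : int := qfb Q ^+ 2 - 4 * qfa Q * qfc Q.

Definition forms_of_disc (D : nat) : set qform := [set Q | qdisc Q = D%:Z].

(* D is the discriminant of some form iff D is 0 or 1 mod 4. *)
Definition is_discriminant (D : nat) : Prop := exists Q, forms_of_disc D Q.

Definition qsgn (Q : qform) : int :=
  if qfa Q != 0 then sgz (qfa Q) else sgz (qfc Q).

Definition qeval {K : pzRingType} (Q : qform) (z : K) : K :=
  (qfa Q)%:~R * z ^+ 2 + (qfb Q)%:~R * z + (qfc Q)%:~R.

Definition qtau {R : realType} (Q : qform) (tau : R[i]) : R :=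
  ((qfa Q)%:~R * (Re tau ^+ 2 + Im tau ^+ 2) + (qfb Q)%:~R * Re tau
     + (qfc Q)%:~R) / Im tau.

Definition semicircle {R : realType} (Q : qform) : set R[i] :=
  [set tau | upper_half_plane tau /\ qtau Q tau = 0].

Definition under_semicircle {R : realType} (Q : qform) : set R[i] :=
  [set tau | upper_half_plane tau /\
     exists2 sigma, semicircle Q sigma & Re sigma = Re tau /\ Im tau < Im sigma].

(* The indicator 1_Q of the region bounded by S_Q and the real line.  The
   parameter [w] is the value given to points of the bounding arc S_Q:
   [w = 0] is the open region, [w = 1] the region together with its arc and
   [w = 1/2] the average of the values on both sides of the arc. *)
Definition region_ind {R : realType} (w : R) (Q : qform) (tau : R[i]) : R :=
  if `[< under_semicircle Q tau >] then 1
  else if `[< semicircle Q tau >] then w else 0.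

(* For a non-square D, each of the sums below has only finitely many non-zero
   terms (for P_g: a point tau = u + i v lies under or on S_Q only if
   4 a^2 v^2 + (2 a u + b)^2 <= D), hence is a genuine finitely supported
   sum. *)
Definition P_g {R : realType} (w : R) (k D : nat) (tau : R[i]) : R[i] :=
  \sum_(Q \in forms_of_disc D)
    (qsgn Q)%:~R * (region_ind w Q tau)%:C / qeval Q tau ^+ k.+1.

Definition q_g {R : realType} (k D : nat) (tau : R[i]) : R[i] :=
  \sum_(Q \in forms_of_disc D `&` [set Q | qfb Q ^+ 2 < D%:Z])
    (qsgn Q)%:~R / qeval Q tau ^+ k.+1.

Definition P_g_rat {R : realType} (k D : nat) (x : rat) : R[i] :=
  - 2 * \sum_(Q \in forms_of_disc D `&` [set Q | qfa Q < 0 /\ 0 < qeval Q x])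
          (qeval Q (ratr x : R[i]) ^+ k.+1)^-1.

(* The type R[i]^o carries the topology of the complex norm.  An unrestricted
   limit tau -> x in the upper half-plane does not exist for P_g, since P_g is unbounded in every neighbourhood of x; the limit at a cusp is
   taken non-tangentially, i.e. within every sector with vertex x. *)
Definition cusp_limit {R : realType} (F : R[i]^o -> R[i]^o) (x : rat)
    (l : R[i]^o) : Prop :=
  forall M : R, 0 < M ->
    F tau @[tau --> within
      [set tau | upper_half_plane tau /\ `|Re tau - ratr x| <= M * Im tau]
      (nbhs ((ratr x)%:C : R[i]^o))] --> l.

Definition real_analytic_at {R : realType} (h : R -> R[i]) (t : R) : Prop :=
  exists c : nat -> R[i],
    \forall s \near t, series (fun n => c n * (s - t)%:C ^+ n : R[i]^o) @ \oo
      --> (h s : R[i]^o).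

(* The trivial-multiplier (Haupttypus) case for the full modular group.  As x
   ranges over rationals only, x is required to have finite image under g; the
   continuation agrees with h_g at every other rational outside of S_g. *)
Definition weak_quantum_modular {R : realType} (f : rat -> R[i]) (r : int) :
    Prop :=
  forall g : 'M[int]_2, \det g = 1 ->
    exists2 Sg : set R, finite_set Sg &
    exists2 h : R -> R[i],
      (forall t, ~ Sg t -> real_analytic_at h t) &
      forall x : rat,
        let num := (g 0 0)%:~R * x + (g 0 1)%:~R in
        let den := (g 1 0)%:~R * x + (g 1 1)%:~R in
        ~ Sg (ratr x) -> den != 0 ->
        h (ratr x) = f x - (ratr den : R[i]) ^ (- r) * f (num / den).

(* Main.v *)
(** Write [Q_g] for the pullback of a form under [g] in SL_2(Z).  Since
    [Q_g(z) = (r z + s)^2 Q(g z)], and [a |z|^2 + b Re z + c], whose sign decides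
    the indicator, scales by [|r z + s|^2] in the same way, reindexing the
    sum over [Q_D] shows that [P(g z) / (r z + s)^(2k+2)] is the sum [P(z)] with
    [sgn a] replaced by the sign of [Q(s, -r)], the leading coefficient of the
    pullback under the inverse of [g].  The two sums differ only in the forms
    with [a Q(s, -r) < 0]; there the indicators are complementary and the
    difference is [sgn a / Q(z)^(k+1)].  These forms are finitely many, because
    [(2 a x + b)^2 = D + 4 a Q(x) <= D] at [x = - s / r].  For [z] in the upper
    half-plane this gives both transformation laws; for rational [z] it exhibits
    the error to modularity as a finite sum of [+- 1 / Q^(k+1)], which is real
    analytic away from the roots of the forms involved.

    For the limit at [x]: if [Q] contributes at a point of a sector with vertex
    [x], then [(2 a x + b)^2] is bounded in terms of [D] and the aperture, which
    leaves finitely many forms, and termwise limits can be taken. *)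

Require Import Defs.
From HB Require Import structures.
From mathcomp Require Import all_boot all_order all_algebra.
From mathcomp Require Import all_classical all_reals all_analysis.
From mathcomp Require Import complex.
From mathcomp Require Import ring lra.

Import Order.TTheory GRing.Theory Num.Theory.
Import numFieldNormedType.Exports.
Import complex.

Local Open Scope classical_set_scope.
Local Open Scope ring_scope.
Local Open Scope complex_scope.

(** * The action of integral matrices on quadratic forms *)

(** Coefficients of [Q(p X + q Y, r X + s Y)]. *)
Definition qact (p q r s : int) (Q : qform) : qform :=
  (qfa Q * p ^+ 2 + qfb Q * p * r + qfc Q * r ^+ 2,
   2 * qfa Q * p * q + qfb Q * (p * s + q * r) + 2 * qfc Q * r * s,
   qfa Q * q ^+ 2 + qfb Q * q * s + qfc Q * s ^+ 2).

Lemma qdisc_act p q r s Q :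
  qdisc (qact p q r s Q) = (p * s - q * r) ^+ 2 * qdisc Q.
Proof. by rewrite /qdisc /qact /qfa /qfb /qfc /=; ring. Qed.

Lemma qactK {p q r s} : p * s - q * r = 1 ->
  cancel (qact p q r s) (qact s (- q) (- r) p).
Proof.
move=> det1 [[a b] c]; rewrite /qact /qfa /qfb /qfc /=.
congr (_, _, _).
(* Composing with the adjugate scales the form by the squared determinant, an identity that [ring]
   proves without the hypothesis [det1]. *)
- by transitivity (a * (p * s - q * r) ^+ 2); [ring|rewrite det1; ring].
- by transitivity (b * (p * s - q * r) ^+ 2); [ring|rewrite det1; ring].
- by transitivity (c * (p * s - q * r) ^+ 2); [ring|rewrite det1; ring].
Qed.

Lemma qact_bij D p q r s : p * s - q * r = 1 ->
  set_bij (forms_of_disc D) (forms_of_disc D) (qact p q r s).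
Proof.
move=> det1; have det1' : s * p - (- q) * (- r) = 1 by rewrite -det1; ring.
split.
- by move=> Q; rewrite /forms_of_disc /= qdisc_act det1 => ->; ring.
- by move=> Q Q' _ _ /(can_inj (qactK det1)).
- move=> Q QD; exists (qact s (- q) (- r) p Q).
    by move: QD; rewrite /forms_of_disc /= qdisc_act det1' => ->; ring.
  by rewrite -{2}(qactK det1' Q) !opprK.
Qed.

(** The matrix sends [(z, 1)] to [(r z + s)(g z, 1)], and the pullback under the inverse undoes it;
    homogeneity of degree 2 yields the factor. *)
Lemma qeval_act {K : fieldType} {p q r s : int} (Q : qform) (z : K) :
    p * s - q * r = 1 -> r%:~R * z + s%:~R != 0 ->
  qeval (qact s (- q) (- r) p Q) ((p%:~R * z + q%:~R) / (r%:~R * z + s%:~R))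
    * (r%:~R * z + s%:~R) ^+ 2 = qeval Q z.
Proof.
move=> det1 nz; rewrite /qeval /qact /qfa /qfb /qfc /=.
rewrite !(rmorphD, rmorphN, rmorphM, rmorphXn) /=.
set a : K := Q.1.1%:~R; set b : K := Q.1.2%:~R; set c : K := Q.2%:~R.
have det1K : p%:~R * s%:~R - q%:~R * r%:~R = 1 :> K.
  by rewrite -!rmorphM -rmorphB det1.
set P : K := p%:~R in det1K *; set U : K := q%:~R in det1K *.
set V : K := r%:~R in nz det1K *; set S : K := s%:~R in nz det1K *.
transitivity ((a * z ^+ 2 + b * z + c) * (P * S - U * V) ^+ 2); last first.
  by rewrite det1K expr1n mulr1.
by field.
Qed.

(* For [tau] in the upper half-plane [qnum Q tau] is [Q_tau * Im tau], and for
   real [tau] it is [Q(tau, 1)]: this treats both cases at once. *)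
Definition qnum {R : realType} (Q : qform) (tau : R[i]) : R :=
  (qfa Q)%:~R * (Re tau ^+ 2 + Im tau ^+ 2) + (qfb Q)%:~R * Re tau
    + (qfc Q)%:~R.

Section upper_half_plane.
Context {R : realType}.
Implicit Types (Q : qform) (z : R[i]).

Lemma mulcJ z : z * z^* = (Re z ^+ 2 + Im z ^+ 2)%:C.
Proof.
case: z => u v; apply/eqP; rewrite eq_complex.
by apply/andP; split; apply/eqP => /=; ring.
Qed.

Lemma qnumE Q z : (qnum Q z)%:C =
  (qfa Q)%:~R * (z * z^*) + (qfb Q)%:~R * ((z + z^*) / 2) + (qfc Q)%:~R.
Proof.
rewrite /qnum -ReJ_add.
rewrite mulcJ.
by rewrite !(rmorphD, rmorphM, rmorph_int).
Qed.

Lemma qnum_real Q (x : R) : qnum Q x%:C = qeval Q x.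
Proof. by rewrite /qnum /qeval /= expr0n addr0. Qed.

Lemma qeval_real Q (x : R) : qeval Q x%:C = (qeval Q x)%:C.
Proof. by rewrite /qeval !(rmorphD, rmorphM, rmorphXn, rmorph_int). Qed.

(** The Hermitian analogue of [qeval_act]. The factor [|r z + s|^2] is kept abstract, since only the
    sign of [qnum] enters the indicator. *)
Lemma qnum_act {p q r s : int} Q z :
    p * s - q * r = 1 -> r%:~R * z + s%:~R != 0 ->
  exists2 l : R, 0 < l &
  qnum (qact s (- q) (- r) p Q) ((p%:~R * z + q%:~R) / (r%:~R * z + s%:~R)) * l
    = qnum Q z.
Proof.
move=> det1 nz.
have conj_lin (m n : int) :
    ((m%:~R * z + n%:~R)^* = m%:~R * z^* + n%:~R :> R[i])%R.
  by rewrite rmorphD rmorphM !rmorph_int.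
have nzc : r%:~R * z^* + s%:~R != 0 :> R[i].
  by rewrite -conj_lin conjC_eq0.
exists (Re (r%:~R * z + s%:~R) ^+ 2 + Im (r%:~R * z + s%:~R) ^+ 2).
  by rewrite -ltcR add_Re2_Im2 exprn_gt0 // normr_gt0.
apply: (@complexI R); rewrite rmorphM /= -mulcJ !qnumE.
rewrite rmorphM fmorphV !conj_lin.
rewrite /qact /qfa /qfb /qfc /=.
rewrite !(rmorphD, rmorphN, rmorphM, rmorphXn) /=.
(* The identity is polarized: it holds with the conjugate replaced by an independent variable, which
   brings it within reach of [field]. *)
move: (z^*)%R nzc => zc nzc.
set a : R[i] := Q.1.1%:~R; set b : R[i] := Q.1.2%:~R; set c : R[i] := Q.2%:~R.
have det1K : p%:~R * s%:~R - q%:~R * r%:~R = 1 :> R[i].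
  by rewrite -!rmorphM -rmorphB det1.
set P : R[i] := p%:~R in det1K *; set U : R[i] := q%:~R in det1K *.
set V : R[i] := r%:~R in nz nzc det1K *; set S : R[i] := s%:~R in nz nzc det1K *.
transitivity ((a * (z * zc) + b * ((z + zc) / 2) + c) * (P * S - U * V) ^+ 2);
  last by rewrite det1K expr1n mulr1.
by field; rewrite nz nzc.
Qed.
End upper_half_plane.

(** * Forms of non-square discriminant: non-vanishing and finiteness *)

Lemma nonsquare_rat {D : nat} (y : rat) :
  ~ (exists m : nat, D = (m ^ 2)%N) -> y ^+ 2 != D%:R.
Proof.
move=> nsq; apply/eqP => yD; apply: nsq.
have dn0 : (denq y)%:~R != 0 :> rat by rewrite intr_eq0 denq_eq0.
have : numq y ^+ 2 = D%:Z * denq y ^+ 2.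
  apply: (@intr_inj rat); rewrite [RHS]rmorphM !rmorphXn /= -[D%:Z%:~R]/(D%:R) -yD.
  by rewrite -{2}(divq_num_den y) expr_div_n divfK // expf_neq0.
move/(congr1 absz); rewrite abszM !abszX absz_nat => nD.
have : (`|denq y| ^ 2 %| `|numq y| ^ 2)%N by rewrite nD dvdn_mull.
rewrite dvdn_pexp2r // => /dvdnP[m mE]; exists m.
move/eqP: nD; rewrite mE expnMn eqn_pmul2r ?expn_gt0 ?absz_gt0 ?denq_eq0 //.
by move/eqP.
Qed.

(** Completing the square. This is the source of the non-vanishing statements, the coefficient
    bounds and the real roots. *)
Lemma discE {K : comPzRingType} {D Q} (y : K) : forms_of_disc D Q ->
  (2 * (qfa Q)%:~R * y + (qfb Q)%:~R) ^+ 2 = D%:R + 4 * (qfa Q)%:~R * qeval Q y.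
Proof.
rewrite /forms_of_disc /= /qdisc => /(congr1 (fun n : int => n%:~R : K)).
by rewrite rmorphB rmorphXn !rmorphM /= -[D%:~R]/(D%:R) /qeval => <-; ring.
Qed.

Lemma qeval_rat_neq0 {D Q} (x : rat) : ~ (exists m : nat, D = (m ^ 2)%N) ->
  forms_of_disc D Q -> qeval Q x != 0.
Proof.
move=> nsq QD; apply/eqP => Qx0.
have := nonsquare_rat (2 * (qfa Q)%:~R * x + (qfb Q)%:~R) nsq.
by rewrite (discE _ QD) Qx0 mulr0 addr0 eqxx.
Qed.

Lemma qfa_neq0 {D Q} : ~ (exists m : nat, D = (m ^ 2)%N) ->
  forms_of_disc D Q -> qfa Q != 0.
Proof.
move=> nsq QD; apply/eqP => a0.
have := nonsquare_rat (qfb Q)%:~R nsq.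
by have := discE (0 : rat) QD; rewrite a0 !(mulr0, mul0r) add0r addr0 => ->; rewrite eqxx.
Qed.

Lemma finite_absz_le (N : nat) : finite_set [set n : int | (`|n| <= N)%N].
Proof.
apply: (@sub_finite_set _ _
  ((fun i : nat => i%:Z) @` `I_N.+1 `|` (fun i : nat => - i%:Z) @` `I_N.+1)).
  move=> n /=; case: (intP n) => [|m|m] mN.
  - by left; exists 0%N.
  - by left; exists m.+1.
  - by right; exists m.+1.
by rewrite finite_setU; split; apply: finite_image; apply: finite_II.
Qed.

(* [qeval Q x] is a nonzero multiple of [1 / denq x ^ 2], so that
   [4 a Q(x) = (2 a x + b)^2 - D] bounds [a]. *)
Lemma finite_forms {D} (x : rat) (B : nat) : ~ (exists m : nat, D = (m ^ 2)%N) ->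
  finite_set (forms_of_disc D `&`
    [set Q | (2 * (qfa Q)%:~R * x + (qfb Q)%:~R) ^+ 2 <= B%:R]).
Proof.
move=> nsq.
(* Bounds for [|a|], [|b|], [|c|]. With [y = 2 a x + b]: [N1] comes from [|4 a Q(x)| <= B + D] and
   [|Q(x)| q^2 >= 1]; [N2] from [|y| <= B + 1] and [|x| <= |numq x|]; [N3] from [4 |a c| <= b^2 + D]
   with [a] nonzero. *)
set q := `|denq x|%N; set N1 := ((B + D) * q ^ 2)%N.
set N2 := (B + 1 + 2 * N1 * `|numq x|)%N; set N3 := (N2 ^ 2 + D)%N.
apply: (@sub_finite_set _ _ (([set n : int | (`|n| <= N1)%N] `*`
  [set n : int | (`|n| <= N2)%N]) `*` [set n : int | (`|n| <= N3)%N])); last first.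
  by do 2 ?apply: finite_setX; apply: finite_absz_le.
move=> Q [QD /= QB].
have qE : (denq x)%:~R = q%:R :> rat by rewrite pmulrn /q absz_denq.
have q0 : 0 < q%:R :> rat by rewrite -qE ltr0z denq_gt0.
have absE (n : int) : `|n%:~R| = `|n|%N%:R :> rat.
  by rewrite -intr_norm -abszE.
set m := qfa Q * numq x ^+ 2 + qfb Q * numq x * denq x + qfc Q * denq x ^+ 2.
have mE : qeval Q x * q%:R ^+ 2 = m%:~R.
  rewrite !(rmorphD, rmorphM, rmorphXn) /= qE /qeval -{1 2}(divq_num_den x) qE.
  by field; rewrite gt_eqF.
have m0 : 1 <= `|qeval Q x| * q%:R ^+ 2.
  rewrite -[q%:R ^+ 2](@ger0_norm rat) ?exprn_ge0 // -normrM mE absE ler1n lt0n.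
  rewrite absz_eq0 -(intr_eq0 rat) -mE mulf_neq0 //.
    exact: (qeval_rat_neq0 x nsq QD).
  by rewrite expf_neq0 // gt_eqF.
set y := 2 * (qfa Q)%:~R * x + (qfb Q)%:~R in QB.
have yE : y ^+ 2 = D%:R + 4 * (qfa Q)%:~R * qeval Q x := discE x QD.
have aN1 : (`|qfa Q| <= N1)%N.
  rewrite -(ler_nat rat) -absE /N1 natrM natrX natrD.
  have : `|4 * (qfa Q)%:~R * qeval Q x| <= B%:R + D%:R.
    have -> : 4 * (qfa Q)%:~R * qeval Q x = y ^+ 2 - D%:R by rewrite yE; ring.
    rewrite (le_trans (ler_normB _ _)) // lerD //.
      by rewrite ger0_norm ?sqr_ge0.
    by rewrite ger0_norm.
  rewrite -(ler_pM2r (exprn_gt0 2 q0)); apply: le_trans.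
  rewrite normrM -mulrA normrM [`|4|]ger0_norm //.
  have := ler_wpM2l (normr_ge0 (qfa Q)%:~R : 0 <= _ :> rat) m0.
  have := normr_ge0 ((qfa Q)%:~R : rat); lra.
have bN2 : (`|qfb Q| <= N2)%N.
  rewrite -(ler_nat rat) -absE /N2 natrD (natrD _ B) (natrM _ (2 * N1)) (natrM _ 2).
  have -> : (qfb Q)%:~R = y - 2 * (qfa Q)%:~R * x by rewrite /y; ring.
  rewrite (le_trans (ler_normB _ _)) // lerD //.
    have := sqr_ge0 (`|y| - 1); rewrite sqrrB1 real_normK ?num_real //.
    by have := normr_ge0 y; have := ler0n rat B; lra.
  rewrite !normrM [`|2|]ger0_norm // ler_pM ?mulr_ge0 //.
    by rewrite ler_pM2l // absE ler_nat.
  rewrite -{1}(divq_num_den x) normf_div absE qE ler_pdivrMr ?normr_gt0 ?gt_eqF //.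
  by rewrite ler_peMr // ger0_norm ?ler1n // -(ltr0n rat).
split => //=; rewrite /N3.
have a1 : (0 < `|qfa Q|)%N by rewrite absz_gt0 (qfa_neq0 nsq QD).
have : (`|qfb Q| ^ 2 <= N2 ^ 2)%N by rewrite leq_exp2r.
move: QD; rewrite /forms_of_disc /= /qdisc.
move: (N2 ^ 2)%N => N22 QD bN.
have : (4 * `|qfa Q| * `|qfc Q| <= N22 + D)%N.
  have -> : (4 * `|qfa Q| * `|qfc Q| = `|qfb Q ^+ 2 - D|)%N.
    by rewrite -QD opprB addrC subrK !abszM.
  apply: (leq_trans (leqD_dist _ 0 _)).
  by rewrite subr0 sub0r abszN abszX leq_add2r.
by apply: leq_trans; rewrite leq_pmull // muln_gt0.
Qed.

(** * The region under the arc as a sign condition *)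

Definition ind {R : realType} (w y : R) : R :=
  if y < 0 then 1 else if y == 0 then w else 0.

Section indicator.
Context {R : realType}.
Implicit Types (Q : qform) (z : R[i]) (w : R).

Lemma ind_pM w l y : 0 < l -> ind w (y * l) = ind w y.
Proof. by move=> l0; rewrite /ind pmulr_llt0 // mulf_eq0 (gt_eqF l0) orbF. Qed.

Lemma ind_supp w y : 0 < y -> ind w y = 0.
Proof. by move=> y0; rewrite /ind lt_gtF // gt_eqF. Qed.

(** At [y = 0] the identity reads [w = 1 - w]: either the arc carries the average value or the point
    must lie off it. *)
Lemma indN w y : w = 2^-1 \/ y != 0 -> ind w (- y) = 1 - ind w y.
Proof.
rewrite /ind oppr_lt0 oppr_eq0.
by case: ltgtP => //= [_|_|_ [->|//]]; rewrite ?subr0 ?subrr //; lra.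
Qed.

Lemma qsgnE D Q : ~ (exists m : nat, D = (m ^ 2)%N) -> forms_of_disc D Q ->
  qsgn Q = sgz (qfa Q).
Proof. by move=> nsq /(qfa_neq0 nsq); rewrite /qsgn => ->. Qed.

Lemma sgz_intrE (n : int) : (sgz n)%:~R = Num.sg n%:~R :> R.
Proof. by rewrite sgrEz sgz_int. Qed.

(** Along a vertical line [qnum Q] varies as [a (Im z)^2] plus a constant, so [sgn a * qnum] is
    negative exactly below the arc. *)
Lemma region_indE w Q z : qfa Q != 0 -> upper_half_plane z ->
  region_ind w Q z = ind w ((sgz (qfa Q))%:~R * qnum Q z).
Proof.
move=> a0 z_up; rewrite sgz_intrE.
have a0R : (qfa Q)%:~R != 0 :> R by rewrite intr_eq0.
have qtauE (t : R[i]) : upper_half_plane t -> (qtau Q t == 0) = (qnum Q t == 0).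
  by rewrite /upper_half_plane /= => t0; rewrite /qtau mulf_eq0 invr_eq0 (gt_eqF t0) orbF.
rewrite /region_ind /ind.
have -> : `[< under_semicircle Q z >] = (Num.sg (qfa Q)%:~R * qnum Q z < 0).
  apply/asboolP/idP.
    move=> [_ [s [s_up /eqP]]]; rewrite (qtauE _ s_up) => /eqP s0 [uE vE].
    have -> : qnum Q z = - (qfa Q)%:~R * (Im s ^+ 2 - Im z ^+ 2).
      by rewrite -[LHS]subr0 -s0 /qnum uE; ring.
    rewrite mulrA mulrN -normrEsg mulNr oppr_lt0 mulr_gt0 ?normr_gt0 // subr_gt0.
    by rewrite ltr_pXn2r // nnegrE ltW // (lt_trans z_up).
  move=> neg; split=> //.
  (* The squared height at which the vertical line through [z] meets the arc. *)
  set s2 := Im z ^+ 2 - qnum Q z / (qfa Q)%:~R.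
  have s2z : Im z ^+ 2 < s2.
    rewrite /s2 ltrDl oppr_gt0.
    case: (ltgtP (qfa Q)%:~R (0 : R)) neg a0R => // a_sg.
      by rewrite ltr0_sg // mulN1r oppr_lt0 ltr_ndivrMr // mul0r.
    by rewrite gtr0_sg // mul1r ltr_pdivrMr // mul0r.
  have s2_gt0 : 0 < s2 by rewrite (lt_trans _ s2z) // exprn_gt0.
  have s_up : upper_half_plane (Re z +i* Num.sqrt s2).
    by rewrite /upper_half_plane /= sqrtr_gt0.
  exists (Re z +i* Num.sqrt s2); [split => //|split => //=].
    apply/eqP; rewrite qtauE //; apply/eqP.
    by rewrite /qnum /= sqr_sqrtr ?ltW // /s2 /qnum; field.
  by rewrite -(ltr_pXn2r (_ : 0 < 2)%N) ?nnegrE ?sqrtr_ge0 ?ltW // sqr_sqrtr // ltW.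
have -> // : `[< semicircle Q z >] = (Num.sg (qfa Q)%:~R * qnum Q z == 0).
rewrite mulf_eq0 sgr_eq0 (negPf a0R) /= -qtauE //.
by apply/asboolP/eqP => [[]|].
Qed.
End indicator.

(** * Finitely supported sums *)

Lemma finite_set_uniq_seq {T : choiceType} (A : set T) : finite_set A ->
  exists2 s : seq T, uniq s & A = [set` s].
Proof.
move=> /finite_seqP[s ->]; exists (undup s); first exact: undup_uniq.
by apply/seteqP; split=> x /=; rewrite mem_undup.
Qed.

Lemma fsum_seq {K : nzRingType} {T : choiceType} (S : set T) (s : seq T) (f : T -> K) :
    uniq s -> [set` s] `<=` S -> (forall Q, S Q -> Q \notin s -> f Q = 0) ->
  \sum_(Q \in S) f Q = \sum_(Q <- s) f Q.
Proof.
move=> s_uniq sS f0; rewrite [RHS]fsbig_seq //; apply/esym/fsbig_widen => //.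
by move=> Q [SQ /= /negP nsQ]; exact: f0.
Qed.

(** A sum with infinite support defaults to 0, so additivity requires a common finite list [s]
    outside of which both summands vanish. *)
Lemma fsum_add {K : nzRingType} {T : choiceType} (S : set T) (s : seq T)
    (f g h : T -> K) :
    uniq s -> [set` s] `<=` S ->
    (forall Q, S Q -> Q \notin s -> f Q = 0 /\ g Q = 0) ->
    (forall Q, S Q -> h Q = f Q + g Q) ->
  \sum_(Q \in S) h Q = \sum_(Q \in S) f Q + \sum_(Q \in S) g Q.
Proof.
move=> s_uniq sS fg0 hE.
rewrite (fsum_seq S s h s_uniq sS); last first.
  by move=> Q SQ nsQ; rewrite hE //; have [-> ->] := fg0 Q SQ nsQ; rewrite addr0.
rewrite (fsum_seq S s f s_uniq sS) ?(fsum_seq S s g s_uniq sS); last 2 first.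
- by move=> Q SQ nsQ; have [] := fg0 Q SQ nsQ.
- by move=> Q SQ nsQ; have [] := fg0 Q SQ nsQ.
by rewrite -big_split; apply: eq_big_seq => Q Qs; apply: hE; exact: sS.
Qed.

(** * The transformation law under Moebius maps *)

Section mobius.
Context {R : realType}.
Implicit Types (Q : qform) (z : R[i]) (w : R).

(** Written with [qnum] so that it keeps its meaning at real points, where [region_ind] is 0. *)
Definition P_term w k Q z : R[i] :=
  (sgz (qfa Q))%:~R * (ind w ((sgz (qfa Q))%:~R * qnum Q z))%:C / qeval Q z ^+ k.+1.

Definition P_sum w k D z : R[i] := \sum_(Q \in forms_of_disc D) P_term w k Q z.

Definition in_sector (x : rat) (M : R) z := `|Re z - ratr x| <= M * Im z.

Definition sector_forms D (x : rat) (M : R) : set qform := forms_of_disc D `&`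
  [set Q | (2 * (qfa Q)%:~R * ratr x + (qfb Q)%:~R) ^+ 2 <= 2 * (1 + M ^+ 2) * D%:R].

Lemma finite_sector_forms D x M : ~ (exists m : nat, D = (m ^ 2)%N) ->
  finite_set (sector_forms D x M).
Proof.
move=> nsq; set B : R := 2 * (1 + M ^+ 2) * D%:R.
apply: sub_finite_set (finite_forms x (Num.bound B) nsq) => Q [QD /= QB].
split=> //=; rewrite -(ler_rat R) rmorphXn rmorphD !rmorphM /= !ratr_int !ratr_nat.
rewrite (le_trans QB) // ltW // archi_boundP // /B.
by rewrite !mulr_ge0 ?addr_ge0 ?sqr_ge0.
Qed.

(** A nonzero term forces [a * qnum Q z <= 0], that is [(2 a u + b)^2 + 4 a^2 v^2 <= D]; the sector
    condition carries this bound from [u] to [x]. With [M = 0] the point may be [x] itself. *)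
Lemma P_term_eq0 D x M w k Q z : in_sector x M z -> 0 <= Im z -> 0 <= M ->
  forms_of_disc D Q -> ~ sector_forms D x M Q -> P_term w k Q z = 0.
Proof.
move=> zx v0 M0 QD QnB; rewrite /P_term ind_supp ?mulr0 ?mul0r //.
rewrite ltNge; apply: contra_notN QnB => neg; split => //=.
set a : R := (qfa Q)%:~R; set b : R := (qfb Q)%:~R.
have {}neg : a * qnum Q z <= 0.
  rewrite -[a]mulr_sg_norm -sgz_intrE mulrAC mulr_le0_ge0 //.
have QDE : D%:R = b ^+ 2 - 4 * a * (qfc Q)%:~R :> R.
  have := QD; rewrite /forms_of_disc /= /qdisc => /(congr1 (fun n : int => n%:~R : R)).
  by rewrite rmorphB rmorphXn !rmorphM /= => ->.
move: zx; rewrite /in_sector; set u := Re z in QDE *; set v := Im z in v0 *.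
move=> zx; have {}zx : (u - ratr x) ^+ 2 <= M ^+ 2 * v ^+ 2.
  by rewrite -exprMn -[leLHS]real_normK ?num_real // lerXn2r ?nnegrE ?mulr_ge0.
have zD : (2 * a * u + b) ^+ 2 + 4 * (a * v) ^+ 2 <= D%:R.
  rewrite QDE -subr_ge0; have -> : b ^+ 2 - 4 * a * (qfc Q)%:~R -
    ((2 * a * u + b) ^+ 2 + 4 * (a * v) ^+ 2) = - 4 * (a * qnum Q z).
    by rewrite /qnum -/a -/b -/u -/v; ring.
  by rewrite mulNr oppr_ge0 pmulr_rle0.
(* [(2 a x + b)^2 <= 2 (2 a u + b)^2 + 2 (2 a (u - x))^2], with the two summands at most [2 D] and
   [2 M^2 D]; hence the constant in [sector_forms]. *)
have := ler_wpM2l (sqr_ge0 (2 * a)) zx.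
have := sqr_ge0 (2 * a * u + b + 2 * a * (u - ratr x)).
have := ler_wpM2l (sqr_ge0 M) zD.
have := mulr_ge0 (sqr_ge0 M) (sqr_ge0 (2 * a * u + b)).
have := sqr_ge0 (a * v).
lra.
Qed.

Definition opp_forms D (p q r s : int) : set qform := forms_of_disc D `&`
  [set Q | qfa Q * qfa (qact s (- q) (- r) p Q) < 0].

Lemma finite_opp_forms D p q r s : ~ (exists m : nat, D = (m ^ 2)%N) ->
  finite_set (opp_forms D p q r s).
Proof.
move=> nsq; apply: sub_finite_set (finite_forms (- s%:~R / r%:~R) D nsq).
move=> Q [QD /= neg]; split=> //=.
have [r0|r0] := eqVneq r 0.
  (* For [r = 0] the pullback has leading coefficient [a s^2], so no sign changes. *)
  move: neg; rewrite r0 /qact /qfa /= oppr0 !(mulr0, expr0n, addr0) mulrA -expr2.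
  by rewrite ltNge mulr_ge0 // sqr_ge0.
rewrite (discE _ QD) -lerBrDl subrr.
have r0Q : r%:~R != 0 :> rat by rewrite intr_eq0.
have r2 : 0 < r%:~R ^+ 2 :> rat by rewrite exprn_even_gt0.
rewrite -(pmulr_lle0 _ r2).
have -> : 4 * (qfa Q)%:~R * qeval Q (- s%:~R / r%:~R) * r%:~R ^+ 2 =
    4 * (qfa Q * qfa (qact s (- q) (- r) p Q))%:~R :> rat.
  rewrite /qact /qeval /qfa /qfb /qfc /= !(rmorphD, rmorphN, rmorphM, rmorphXn) /=.
  by field.
by rewrite pmulr_rle0 // lerz0 ltW.
Qed.

(** Allowing [Im z = 0] lets one statement serve the upper half-plane and the rational points. The
    sector supplies finite support; the last hypothesis is what [indN] asks for. *)
Lemma P_sum_mobius {w} k {D} {p q r s : int} {z} : ~ (exists m : nat, D = (m ^ 2)%N) ->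
    p * s - q * r = 1 -> r%:~R * z + s%:~R != 0 ->
    0 <= Im z -> (exists (x : rat) (M : R), 0 <= M /\ in_sector x M z) ->
    w = 2^-1 \/ (forall Q, opp_forms D p q r s Q -> qnum Q z != 0) ->
  P_sum w k D ((p%:~R * z + q%:~R) / (r%:~R * z + s%:~R)) =
  (r%:~R * z + s%:~R) ^+ (2 * k + 2) * (P_sum w k D z -
    \sum_(Q \in opp_forms D p q r s) (sgz (qfa Q))%:~R / qeval Q z ^+ k.+1).
Proof.
move=> nsq det1 nz v0 [x [M [M0 zx]]] w_arc.
set d := r%:~R * z + s%:~R; set g := _ / d.
have det1' : s * p - (- q) * (- r) = 1 by rewrite -det1; ring.
pose opp := [set Q | qfa Q * qfa (qact s (- q) (- r) p Q) < 0].
pose opp_term Q : R[i] :=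
  if Q \in opp then (sgz (qfa Q))%:~R / qeval Q z ^+ k.+1 else 0.
have term_act Q : forms_of_disc D Q -> P_term w k (qact s (- q) (- r) p Q) g =
    d ^+ (2 * k + 2) * (P_term w k Q z - opp_term Q).
  move=> QD; set Q' := qact _ _ _ _ _.
  have Q'D : forms_of_disc D Q' by have [+ _ _] := qact_bij D _ _ _ _ det1'; apply.
  have a0 := qfa_neq0 nsq QD; have a'0 := qfa_neq0 nsq Q'D.
  have [l l0 nE] := qnum_act Q z det1 nz.
  have indE c : ind w (c * qnum Q' g) = ind w (c * qnum Q z).
    by rewrite -nE mulrA; apply/esym/ind_pM.
  rewrite /opp_term /P_term indE -(qeval_act Q z det1 nz) -/d -/g -/Q'.
  have -> : (2 * k + 2 = 2 * k.+1)%N by rewrite mulnS addnC.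
  rewrite [(qeval Q' g * _) ^+ _]exprMn invfM -exprM.
  have dk : d ^+ (2 * k.+1) != 0 by rewrite expf_neq0.
  set e := (qeval Q' g ^+ k.+1)^-1.
  set n := qnum Q z.
  (* With [e] the sign of [a], a sign change gives [- e (1 - ind) = e ind - e], and the last summand
     is [opp_term]. *)
  have [neg|] := boolP (Q \in opp).
    move: neg; rewrite inE /opp /= -/Q' => neg.
    have -> : sgz (qfa Q') = - sgz (qfa Q).
      by move: neg; rewrite -sgz_lt0 sgzM; case: sgzP a0 => // _ _; case: sgzP a'0.
    rewrite !rmorphN !mulNr indN; last first.
      case: w_arc => [|arc]; [by left|right].
      by rewrite mulf_neq0 ?intr_eq0 ?sgz_eq0 // arc.
    by rewrite rmorphB rmorph1; field.
  rewrite notin_setE /opp /= -/Q' => /negP; rewrite -leNgt => pos.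
  have -> : sgz (qfa Q') = sgz (qfa Q).
    by move: pos; rewrite -sgz_ge0 sgzM; case: sgzP a0 => // _ _; case: sgzP a'0.
  by rewrite subr0; field.
rewrite [LHS](reindex_fsbig (qact s (- q) (- r) p) (forms_of_disc D)
  (forms_of_disc D) (fun Q => P_term w k Q g) (qact_bij D _ _ _ _ det1')).
transitivity (\sum_(Q \in forms_of_disc D)
    d ^+ (2 * k + 2) * (P_term w k Q z - opp_term Q)).
  by apply: eq_fsbigr => Q; rewrite inE; exact: term_act.
rewrite -mulr_fsumr; congr (_ * _).
(* Outside this finite union both the term and its correction vanish, so the sum may be split. *)
have /finite_set_uniq_seq[t t_uniq tE] :
    finite_set (sector_forms D x M `|` opp_forms D p q r s).
  by rewrite finite_setU; split; [exact: finite_sector_forms|exact: finite_opp_forms].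
have tD : [set` t] `<=` forms_of_disc D by rewrite -tE => Q [] [].
have -> : \sum_(Q \in opp_forms D p q r s) (sgz (qfa Q))%:~R / qeval Q z ^+ k.+1 =
    \sum_(Q \in forms_of_disc D) opp_term Q by exact: fsbig_mkcondr.
apply/eqP; rewrite eq_sym subr_eq; apply/eqP.
apply: (fsum_add _ t) t_uniq tD _ _ => Q QD; last by rewrite subrK.
move=> nt; have {}nt : ~ (sector_forms D x M `|` opp_forms D p q r s) Q.
  by rewrite tE; exact/negP.
have -> : P_term w k Q z = 0.
  by apply: (P_term_eq0 _ _ _ _ _ _ _ zx v0 M0 QD) => QS; apply: nt; left.
rewrite sub0r /opp_term memNset ?oppr0 // => neg.
by apply: nt; right.
Qed.
End mobius.

(** * Real analyticity of inverse powers of a quadratic polynomial *)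

Section power_series.
Context {R : realType}.
Local Notation normc := Normc.normc.
Implicit Types (x y l : R[i]) (t : R) (h : R -> R[i]).

Lemma normc_ge0 x : 0 <= normc x.
Proof. by case: x => a b; exact: sqrtr_ge0. Qed.

Lemma normc_gt0 x : x != 0 -> 0 < normc x.
Proof.
move=> x0; rewrite lt_neqAle normc_ge0 andbT eq_sym.
by apply: contraNneq x0 => /Normc.eq0_normc ->.
Qed.

Lemma normc_real t : normc t%:C = `|t|.
Proof. by rewrite /= expr0n addr0 sqrtr_sqr. Qed.

Lemma normcX x n : normc (x ^+ n) = normc x ^+ n.
Proof. by elim: n => [|n IH]; rewrite ?expr0 ?Normc.normc1 // !exprS Normc.normcM IH. Qed.

Lemma cvg0_normc {T} {F : set_system T} {FF : Filter F} (f : T -> R[i]) (g : T -> R) :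
    (forall i, normc (f i) <= g i) -> g i @[i --> F] --> (0 : R) ->
  (f i : R[i]^o) @[i --> F] --> (0 : R[i]^o).
Proof.
move=> fg /cvgr0Pnorm_lt g0; apply/cvgr0Pnorm_lt => e e0.
have eR : (Re e)%:C = e by apply: RRe_real; rewrite realE ltW.
have Re_e0 : 0 < Re e by rewrite -ltcR eR.
apply: filterS (g0 _ Re_e0) => i gi.
rewrite -eR; change ((normc (f i))%:C < (Re e)%:C).
by rewrite ltcR (le_lt_trans (fg i)) // (le_lt_trans _ gi) // ler_norm.
Qed.

Lemma cvg_scaled_expr (C z : R) : `|z| < 1 -> C * z ^+ n @[n --> \oo] --> (0 : R).
Proof.
by move=> z1; rewrite -[0](mulr0 C); apply: cvgM; [exact: cvg_cst|exact: cvg_expr].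
Qed.

(* The power series of [f / (y - b)] from that of [f]: its coefficients solve
   [v_(n-1) - b v_n = u_n]. *)
Fixpoint div_coef (b : R[i]) (u : nat -> R[i]) (n : nat) : R[i] :=
  if n is m.+1 then (div_coef b u m - u n) / b else - u 0%N / b.

Definition geometric_coef (u : nat -> R[i]) (C B : R) :=
  [/\ 0 <= C, 0 < B & forall n, normc (u n) <= C * B ^+ n].

(** The new rate [B'] exceeds [2 / |b|], so the previous coefficient is at most [C B'^(n+1)], the
    same bound as for [u]; dividing the two by [b] reproduces the constant [2 C / |b|]. *)
Lemma geometric_div_coef b u C B : b != 0 -> geometric_coef u C B ->
  geometric_coef (div_coef b u) (2 * C / normc b) (B + 2 / normc b).
Proof.
move=> b0 [C0 B0 uC].
have nb0 := normc_gt0 _ b0.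
have nbV : 0 < (normc b)^-1 by rewrite invr_gt0.
have B'0 : 0 < B + 2 / normc b by rewrite addr_gt0 // mulr_gt0.
set B' := B + 2 / normc b in B'0 *.
split => //; first by rewrite !mulr_ge0 // ltW.
have uB' n : normc (u n) <= C * B' ^+ n.
  rewrite (le_trans (uC n)) // ler_wpM2l // lerXn2r ?nnegrE ?ltW //.
  by rewrite ltrDl mulr_gt0.
elim => [|n IH].
  rewrite /= Normc.normcM Normc.normcV normcN expr0 mulr1 ler_pM2r //.
  by have := uB' 0%N; rewrite expr0 mulr1; lra.
rewrite [div_coef _ _ _]/= Normc.normcM Normc.normcV.
rewrite -[leRHS]mulrA [(normc b)^-1 * _]mulrC mulrA ler_pM2r //.
apply: le_trans (le_normcD _ _) _; rewrite normcN.
have step : 2 * C / normc b * B' ^+ n <= C * B' ^+ n.+1.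
  rewrite exprS; have -> : 2 * C / normc b * B' ^+ n = C * (2 / normc b * B' ^+ n).
    by ring.
  by rewrite ler_wpM2l // ler_wpM2r ?exprn_ge0 ?ltW // ltrDr.
by rewrite (le_trans (lerD IH (uB' n.+1))) //; lra.
Qed.

(** The recursion telescopes, leaving one top-degree term, which later tends to 0 by the geometric
    bound. *)
Lemma series_div_coef b u y n : b != 0 ->
  (y - b) * series (fun i => div_coef b u i * y ^+ i) n =
  series (fun i => u i * y ^+ i) n +
    (if n is m.+1 then div_coef b u m * y ^+ n else 0).
Proof.
move=> b0; elim: n => [|n IH]; first by rewrite !seriesEnat /= !big_geq // mulr0 addr0.
rewrite !seriesSr mulrDr {}IH.
by case: n => [|n] /=; rewrite ?expr1 ?expr0 ?exprS; field.
Qed.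

Lemma cvg_series_div_coef b u C B y l : b != 0 -> geometric_coef u C B ->
    normc y * (B + 2 / normc b) < 1 ->
    series (fun n => u n * y ^+ n : R[i]^o) @ \oo --> (l : R[i]^o) ->
  series (fun n => div_coef b u n * y ^+ n : R[i]^o) @ \oo --> (l / (y - b) : R[i]^o).
Proof.
move=> b0 uC yB ul; have [C'0 B'0 vC] := geometric_div_coef b u C B b0 uC.
set B' := B + 2 / normc b in yB B'0 vC; set C' := 2 * C / normc b in C'0 vC.
have [_ B0 _] := uC.
have nb0 := normc_gt0 _ b0.
(* At [y = b] the left side of [yB] would be [|b| B + 2 > 1]. *)
have yb : y - b != 0.
  apply: contraTneq yB => /eqP; rewrite subr_eq0 => /eqP ->.
  rewrite -leNgt /B' mulrDr mulrCA divff ?gt_eqF // mulr1.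
  by have := mulr_gt0 nb0 B0; lra.
have rest0 : ((if n is m.+1 then div_coef b u m * y ^+ n else 0) : R[i]^o)
    @[n --> \oo] --> (0 : R[i]^o).
  apply: (cvg0_normc _ (fun n => C' / B' * (normc y * B') ^+ n)) => [[|n]|].
  - by rewrite Normc.normc0 expr0 mulr1 divr_ge0 // ltW.
  - rewrite Normc.normcM normcX.
    have -> : C' / B' * (normc y * B') ^+ n.+1 = C' * B' ^+ n * normc y ^+ n.+1.
      by rewrite exprMn [B' ^+ n.+1]exprS; field; rewrite gt_eqF.
    by rewrite ler_wpM2r // exprn_ge0 // normc_ge0.
  - apply: cvg_scaled_expr; rewrite ger0_norm //.
    by rewrite mulr_ge0 ?normc_ge0 // ltW.
have -> : series (fun n => div_coef b u n * y ^+ n : R[i]^o) =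
  (fun n => (series (fun n => u n * y ^+ n) n +
   (if n is m.+1 then div_coef b u m * y ^+ n else 0)) / (y - b)).
  by apply/funext => n; rewrite -series_div_coef // mulrC mulKf.
rewrite -[l]addr0; apply: (@cvgM (R[i] : numFieldType)); last exact: cvg_cst.
exact: (@cvgD _ (R[i]^o) _ _ _ _ _ _ _ ul rest0).
Qed.

(* The geometric bound on the coefficients makes the class stable under
   division by a linear factor without any appeal to absolute convergence. *)
Definition geometric_analytic_at h t : Prop :=
  exists u C B, geometric_coef u C B /\
    \forall s \near t, series (fun n => u n * (s - t)%:C ^+ n : R[i]^o) @ \oo
      --> (h s : R[i]^o).

Lemma geometric_analytic_real_analytic h t :
  geometric_analytic_at h t -> real_analytic_at h t.
Proof. by move=> [u [C [B [_ uh]]]]; exists u. Qed.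

Lemma geometric_analytic_cst x t : geometric_analytic_at (fun=> x) t.
Proof.
exists (fun n => if n is 0%N then x else 0), (normc x), 1; split.
  split=> [||[|n]]; rewrite ?normc_ge0 ?expr1n ?mulr1 //.
  by rewrite Normc.normc0 normc_ge0.
(* The partial sum of index 0 is empty; from index 1 on the partial sums equal [x]. *)
near=> s; rewrite -(cvg_shiftS _ (nbhs (x : R[i]^o))); apply: cvg_near_cst.
near=> n; rewrite /= seriesEnat /= big_nat_recl // expr0 mulr1 big1 ?addr0 //.
by move=> i _; rewrite mul0r.
Unshelve. all: by end_near.
Qed.

Lemma geometric_analyticZ x h t : geometric_analytic_at h t ->
  geometric_analytic_at (fun s => x * h s) t.
Proof.
move=> [u [C [B [[C0 B0 uC] uh]]]].
exists (fun n => x * u n), (normc x * C), B; split.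
  split=> [||n]; rewrite ?mulr_ge0 ?normc_ge0 //.
  by rewrite Normc.normcM -mulrA ler_wpM2l ?normc_ge0.
apply: filterS uh => s hs.
have -> : series (fun n => x * u n * (s - t)%:C ^+ n : R[i]^o) =
    (fun n => x * series (fun n => u n * (s - t)%:C ^+ n) n).
  apply/funext => n; rewrite !seriesEnat /= mulr_sumr.
  by apply: eq_bigr => i _; rewrite mulrA.
by apply: (@cvgM (R[i] : numFieldType)); first exact: cvg_cst.
Qed.

Lemma geometric_analyticD h1 h2 t :
    geometric_analytic_at h1 t -> geometric_analytic_at h2 t ->
  geometric_analytic_at (fun s => h1 s + h2 s) t.
Proof.
move=> [u1 [C1 [B1 [[C10 B10 uC1] uh1]]]] [u2 [C2 [B2 [[C20 B20 uC2] uh2]]]].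
exists (fun n => u1 n + u2 n), (C1 + C2), (B1 + B2); split.
  split=> [||n]; rewrite ?addr_ge0 ?addr_gt0 //.
  apply: le_trans (le_normcD _ _) _; rewrite mulrDl lerD //.
    rewrite (le_trans (uC1 n)) // ler_wpM2l // lerXn2r ?nnegrE ?addr_ge0 ?ltW //.
    by rewrite ltrDl.
  rewrite (le_trans (uC2 n)) // ler_wpM2l // lerXn2r ?nnegrE ?addr_ge0 ?ltW //.
  by rewrite ltrDr.
apply: filterS2 uh1 uh2 => s h1s h2s.
have -> : series (fun n => (u1 n + u2 n) * (s - t)%:C ^+ n : R[i]^o) =
    (fun n => series (fun n => u1 n * (s - t)%:C ^+ n) n +
              series (fun n => u2 n * (s - t)%:C ^+ n) n).
  apply/funext => n; rewrite !seriesEnat /= -big_split.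
  by apply: eq_bigr => i _; rewrite mulrDl.
exact: (@cvgD _ (R[i]^o) _ _ _ _ _ _ _ h1s h2s).
Qed.

Lemma geometric_analytic_sum {I : eqType} (r : seq I) (h : I -> R -> R[i]) t :
    {in r, forall i, geometric_analytic_at (h i) t} ->
  geometric_analytic_at (fun s => \sum_(i <- r) h i s) t.
Proof.
elim: r => [_|i r IH ht].
  by under eq_fun do rewrite big_nil; exact: geometric_analytic_cst.
have -> : (fun s => \sum_(j <- i :: r) h j s) =
    (fun s => h i s + \sum_(j <- r) h j s).
  by apply/funext => s; rewrite big_cons.
apply: geometric_analyticD; first by apply: ht; rewrite mem_head.
by apply: IH => j jr; apply: ht; rewrite inE jr orbT.
Qed.

(** Recentred at [t] the divisor is [(s - t) - b] with [b = a - t] nonzero, the case handled by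
    [div_coef]. *)
Lemma geometric_analytic_div h (a t : R) : t != a -> geometric_analytic_at h t ->
  geometric_analytic_at (fun s => h s / (s - a)%:C) t.
Proof.
move=> ta [u [C [B [uC uh]]]]; set b : R[i] := (a - t)%:C.
have b0 : b != 0 by rewrite -[0]/(0%:C) (inj_eq (@complexI R)) subr_eq0 eq_sym.
exists (div_coef b u), (2 * C / normc b), (B + 2 / normc b).
have vC := geometric_div_coef b u C B b0 uC; split; first exact: vC.
have [_ B'0 _] := vC.
have near_t : \forall s \near t, `|t - s| < (B + 2 / normc b)^-1.
  move/cvgr_dist_lt: (@cvg_id _ (nbhs t)); apply.
  by rewrite invr_gt0.
apply: filterS2 uh near_t => s hs st.
have -> : (s - a)%:C = (s - t)%:C - b by rewrite /b -rmorphB; congr (_%:C); ring.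
apply: (cvg_series_div_coef b u C B _ _ b0 uC _ hs).
by rewrite normc_real -ltr_pdivlMr // mul1r distrC.
Qed.

Lemma qeval_factor D Q t : (0 < D)%N -> qfa Q != 0 -> forms_of_disc D Q ->
  exists a1 a2 : R, forall s, qeval Q s = (qfa Q)%:~R * (s - a1) * (s - a2).
Proof.
move=> D0 a0 QD; set a : R := (qfa Q)%:~R; set b : R := (qfb Q)%:~R.
have a0R : a != 0 by rewrite intr_eq0.
exists ((- b + Num.sqrt D%:R) / (2 * a)), ((- b - Num.sqrt D%:R) / (2 * a)) => s.
have := discE s QD; rewrite -/a -/b => sD.
have sqD : Num.sqrt D%:R ^+ 2 = D%:R :> R by rewrite sqr_sqrtr.
apply: (mulfI (_ : 4 * a != 0)); first by rewrite mulf_neq0.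
have -> : 4 * a * qeval Q s = (2 * a * s + b) ^+ 2 - Num.sqrt D%:R ^+ 2.
  by rewrite sqD sD; ring.
by field.
Qed.

(** Each factor [1 / Q] amounts to dividing by two linear factors whose roots differ from [t]. *)
Lemma geometric_analytic_qeval D Q t x k : (0 < D)%N -> qfa Q != 0 ->
    forms_of_disc D Q -> qeval Q t != 0 ->
  geometric_analytic_at (fun s => x / (qeval Q s)%:C ^+ k) t.
Proof.
move=> D0 a0 QD Qt0; have [a1 [a2 QE]] := qeval_factor D Q t D0 a0 QD.
have [ta1 ta2] : t != a1 /\ t != a2.
  by split; apply: contraNneq Qt0 => ta; rewrite QE ta subrr !(mulr0, mul0r).
elim: k => [|k IH].
  by under eq_fun do rewrite expr0 divr1; exact: geometric_analytic_cst.
have -> : (fun s => x / (qeval Q s)%:C ^+ k.+1) = (fun s =>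
    ((((qfa Q)%:~R)^-1 * (x / (qeval Q s)%:C ^+ k)) / (s - a1)%:C) / (s - a2)%:C).
  apply/funext => s; rewrite exprSr {2}QE !rmorphM /= rmorph_int.
  by rewrite !invfM; ring.
have h1 := geometric_analytic_div _ _ _ ta1 (geometric_analyticZ (qfa Q)%:~R^-1 _ _ IH).
exact: (geometric_analytic_div _ _ _ ta2 h1).
Qed.
End power_series.

(** * Values at rational points *)

Section rational_points.
Context {R : realType}.
Implicit Types (w : R) (Q : qform) (z : R[i]).

Lemma P_gE w k D z : ~ (exists m : nat, D = (m ^ 2)%N) -> upper_half_plane z ->
  P_g w k D z = P_sum w k D z.
Proof.
move=> nsq z_up; apply: eq_fsbigr => Q; rewrite inE => QD.
by rewrite (qsgnE _ _ nsq QD) region_indE //; exact: qfa_neq0 nsq QD.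
Qed.

Definition qopp (Q : qform) : qform := (- qfa Q, - qfb Q, - qfc Q).

Lemma qeval_opp {K : pzRingType} Q (y : K) : qeval (qopp Q) y = - qeval Q y.
Proof. by rewrite /qeval /qopp /qfa /qfb /qfc /= !rmorphN !mulNr !opprD. Qed.

Lemma qopp_bij D : set_bij (forms_of_disc D) (forms_of_disc D) qopp.
Proof.
have qoppK : involutive qopp.
  by case=> [[a b] c]; rewrite /qopp /qfa /qfb /qfc /= !opprK.
have qdisc_opp Q : qdisc (qopp Q) = qdisc Q.
  by rewrite /qdisc /qopp /qfa /qfb /qfc /=; ring.
split.
- by move=> Q; rewrite /forms_of_disc /= qdisc_opp.
- by move=> Q Q' _ _ /(inv_inj qoppK).
- by move=> Q QD; exists (qopp Q); rewrite ?qoppK // /forms_of_disc /= qdisc_opp.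
Qed.

Lemma in_sector_rat (x : rat) : in_sector x 0 ((ratr x : R)%:C).
Proof. by rewrite /in_sector /= subrr normr0 mulr0. Qed.

Lemma ratrC (x : rat) : (ratr x : R[i]) = (ratr x : R)%:C.
Proof. by rewrite -(fmorph_eq_rat (real_complex R \o ratr)). Qed.

Lemma qeval_ratr Q (x : rat) : qeval Q (ratr x : R) = ratr (qeval Q x).
Proof. by rewrite /qeval !(rmorphD, rmorphM, rmorphXn) /= !ratr_int. Qed.

(* For odd [k + 1], [Q] and [- Q] contribute the same term to [P_sum]. *)
Lemma P_g_ratE w k D (x : rat) : ~ (exists m : nat, D = (m ^ 2)%N) -> ~~ odd k ->
  P_g_rat k D x = P_sum w k D (ratr x)%:C.
Proof.
move=> nsq k_even; set e := fun Q => qeval Q (ratr x : R[i]).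
(* [u Q] is the term of a form with [a < 0 < Q(x)]. Forms with [Q(x) < 0 < a] are covered by
   [u (qopp Q)]; all others contribute 0. *)
pose u Q : R[i] := if (qfa Q < 0) && (0 < qeval Q x) then - (e Q ^+ k.+1)^-1 else 0.
have u_oppE Q : u (qopp Q) =
    if (0 < qfa Q) && (qeval Q x < 0) then (e Q ^+ k.+1)^-1 else 0.
  rewrite /u /e !qeval_opp oppr_gt0 -[qfa (qopp Q)]/(- qfa Q) oppr_lt0.
  case: ifP => // _.
  by rewrite exprNn -signr_odd /= k_even expr1 mulN1r invrN opprK.
have termE Q : forms_of_disc D Q -> P_term w k Q (ratr x)%:C = u Q + u (qopp Q).
  move=> QD; rewrite /P_term qnum_real -ratrC qeval_ratr -/(e Q) u_oppE /u /ind.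
  case: (ltgtP (qfa Q) 0) (qfa_neq0 nsq QD) => // a0 _;
    case: (ltgtP (qeval Q x) 0) (qeval_rat_neq0 x nsq QD) => // v0 _ /=.
  - rewrite ltr0_sgz // !rmorphN1 !mulN1r oppr_lt0 ltr0q ltNge ltW // oppr_eq0.
    by rewrite fmorph_eq0 (lt_eqF v0) oppr0 mul0r addr0.
  - by rewrite ltr0_sgz // !rmorphN1 !mulN1r oppr_lt0 ltr0q v0 mulN1r addr0.
  - by rewrite gtr0_sgz // !rmorph1 !mul1r ltrq0 v0 mul1r add0r.
  - rewrite gtr0_sgz // !rmorph1 !mul1r ltrq0 ltNge ltW // fmorph_eq0 (gt_eqF v0).
    by rewrite mul0r addr0.
have [t t_uniq tE] := finite_set_uniq_seq _ (finite_sector_forms D x (0 : R) nsq).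
have tD : [set` t] `<=` forms_of_disc D by rewrite -tE => Q [].
have u0 Q : forms_of_disc D Q -> Q \notin t -> u Q = 0 /\ u (qopp Q) = 0.
  move=> QD /negP nt.
  have nS : ~ sector_forms D x (0 : R) Q by rewrite tE.
  have := P_term_eq0 _ _ _ w k _ _ (in_sector_rat x) _ _ QD nS.
  rewrite lexx => /(_ isT isT); rewrite termE // u_oppE /u.
  (* The conditions defining [u Q] and [u (qopp Q)] exclude each other, so a vanishing sum makes
     both vanish. *)
  case: ifP => [/andP[a0 _]|_]; last by rewrite add0r.
  by rewrite [0 < _]lt_gtF //= addr0 => ->.
have uE : \sum_(Q \in forms_of_disc D) u (qopp Q) = \sum_(Q \in forms_of_disc D) u Q.
  by rewrite [RHS](reindex_fsbig qopp (forms_of_disc D) _ u (qopp_bij D)).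
transitivity (\sum_(Q \in forms_of_disc D) u Q + \sum_(Q \in forms_of_disc D) u Q).
  rewrite /P_g_rat -mulr2n -[RHS]mulr_natl mulNr -mulrN; congr (_ * _).
  rewrite -mulN1r mulr_fsumr fsbig_mkcondr; apply: eq_fsbigr => Q _.
  rewrite /u -/(e Q) mulN1r; congr (if _ then _ else _).
  by apply/idP/andP; rewrite inE.
by rewrite -{2}uE; apply/esym/(fsum_add _ t).
Qed.

(** * Continuity of the individual terms *)

Lemma normc_ge_Re z : `|Re z| <= Normc.normc z.
Proof. by case: z => a b /=; rewrite -sqrtr_sqr ler_wsqrtr // lerDl sqr_ge0. Qed.

Lemma normc_ge_Im z : `|Im z| <= Normc.normc z.
Proof. by case: z => a b /=; rewrite -sqrtr_sqr ler_wsqrtr // lerDr sqr_ge0. Qed.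

Lemma near_normc z (e : R) : 0 < e ->
  \forall y \near (z : R[i]^o), Normc.normc (z - y) < e.
Proof.
move=> e0; exists e%:C; first by rewrite /= ltcR.
move=> y; change ((Normc.normc (z - y))%:C < e%:C -> Normc.normc (z - y) < e).
by rewrite ltcR.
Qed.

Lemma cvg_Re z : Re y @[y --> nbhs (z : R[i]^o)] --> Re z.
Proof.
apply/cvgrPdist_lt => e e0; apply: filterS (near_normc z e e0) => y.
apply: le_lt_trans; apply: le_trans (normc_ge_Re _).
by case: z y => [a b] [c d].
Qed.

Lemma cvg_Im z : Im y @[y --> nbhs (z : R[i]^o)] --> Im z.
Proof.
apply/cvgrPdist_lt => e e0; apply: filterS (near_normc z e e0) => y.
apply: le_lt_trans; apply: le_trans (normc_ge_Im _).
by case: z y => [a b] [c d].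
Qed.

Lemma cvg_qnum Q z : qnum Q y @[y --> nbhs (z : R[i]^o)] --> qnum Q z.
Proof.
have hRe := cvg_Re z; have hIm := cvg_Im z; rewrite /qnum.
apply: (@cvgD R R^o); last exact: cvg_cst.
apply: (@cvgD R R^o); last by apply: cvgM => //; exact: cvg_cst.
apply: cvgM; first exact: cvg_cst.
by apply: (@cvgD R R^o); rewrite ?expr2; apply: cvgM.
Qed.

Lemma cvg_qeval Q z :
  (qeval Q y : R[i]^o) @[y --> nbhs (z : R[i]^o)] --> (qeval Q z : R[i]^o).
Proof.
rewrite /qeval; apply: (@cvgD _ (R[i]^o)); last exact: cvg_cst.
apply: (@cvgD _ (R[i]^o)).
  apply: (@cvgM (R[i] : numFieldType)); first exact: cvg_cst.
  by apply: (@cvgM (R[i] : numFieldType)); exact: cvg_id.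
by apply: (@cvgM (R[i] : numFieldType)); [exact: cvg_cst|exact: cvg_id].
Qed.

(** The quotient [y' / y] is positive, and [ind] sees only signs. *)
Lemma ind_near w c (y y' : R) : `|y - y'| < `|y| -> ind w (c * y') = ind w (c * y).
Proof.
move=> yy'; have y0 : y != 0 by apply: contraTneq yy' => ->; rewrite normr0 -leNgt.
have -> : y' = y * (y' / y) by field.
rewrite mulrA ind_pM //; move: yy'.
have {1}-> : y - y' = y * (1 - y' / y) by field.
by rewrite normrM gtr_pMr ?normr_gt0 // ltr_norml; lra.
Qed.

(** Where [qnum Q] is nonzero the indicator is locally constant. *)
Lemma cvg_P_term w k Q z : qnum Q z != 0 -> qeval Q z != 0 ->
  (P_term w k Q y : R[i]^o) @[y --> nbhs (z : R[i]^o)] --> (P_term w k Q z : R[i]^o).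
Proof.
move=> n0 e0; rewrite /P_term.
apply: (@cvgM (R[i] : numFieldType)).
  apply: (@cvgM (R[i] : numFieldType)); first exact: cvg_cst.
  apply: cvg_near_cst.
  have := cvg_qnum Q z => /cvgrPdist_lt /(_ `|qnum Q z|).
  rewrite normr_gt0 => /(_ n0); apply: filterS => y yz.
  by congr (_%:C); rewrite (ind_near _ _ _ _ yz).
apply: (@cvgV (R[i] : numFieldType)); first by rewrite expf_neq0.
elim: k => [|k IH]; first by rewrite !expr1; exact: cvg_qeval.
under eq_fun do rewrite exprS.
by rewrite exprS; apply: (@cvgM (R[i] : numFieldType)); [exact: cvg_qeval|].
Qed.
End rational_points.

(** * Cusp limits and weak quantum modularity *)

Lemma det_mx2 {K : comNzRingType} (A : 'M[K]_2) :
  \det A = A 0 0 * A 1 1 - A 0 1 * A 1 0.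
Proof.
rewrite (expand_det_row _ 0) !big_ord_recl big_ord0 addr0 /cofactor !det_mx11 !mxE /=.
have -> : lift (0 : 'I_2) 0 = 1 by apply/val_inj.
have -> : lift (1 : 'I_2) 0 = 0 by apply/val_inj.
by rewrite expr0 expr1 mul1r mulN1r mulrN.
Qed.

Section modular.
Context {R : realType}.
Implicit Types (w : R) (Q : qform) (z : R[i]).

Lemma cvg_sum {T : Type} {F : set_system T} {FF : Filter F} {I : eqType}
    (r : seq I) (f : I -> T -> R[i]^o) (l : I -> R[i]^o) :
    {in r, forall i, f i y @[y --> F] --> l i} ->
  (\sum_(i <- r) f i y : R[i]^o) @[y --> F] --> (\sum_(i <- r) l i : R[i]^o).
Proof.
elim: r => [_|i r IH fl].
  by under eq_fun do rewrite big_nil; rewrite big_nil; exact: cvg_cst.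
under eq_fun do rewrite big_cons; rewrite big_cons.
apply: (@cvgD _ (R[i]^o)); first by apply: fl; rewrite mem_head.
by apply: IH => j jr; apply: fl; rewrite inE jr orbT.
Qed.

Lemma upper_half_plane_opp_inv z : upper_half_plane z -> upper_half_plane (- 1 / z).
Proof.
case: z => u v; rewrite /upper_half_plane /= => v0.
have n0 : 0 < u ^+ 2 + v ^+ 2 by rewrite ltr_wpDl ?sqr_ge0 // exprn_gt0.
rewrite [ltRHS](_ : _ = v / (u ^+ 2 + v ^+ 2)); first by rewrite divr_gt0.
by field; rewrite gt_eqF.
Qed.

Lemma cusp_limit_P_g w k D (x : rat) : ~ (exists m : nat, D = (m ^ 2)%N) ->
  ~~ odd k -> cusp_limit (P_g w k D) x (P_g_rat k D x).
Proof.
move=> nsq k_even M M0; rewrite (P_g_ratE w) //.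
(* A single finite list carries the sum on the whole sector and at its vertex. *)
have [t t_uniq tE] := finite_set_uniq_seq _ (finite_sector_forms D x M nsq).
have tD : [set` t] `<=` forms_of_disc D by rewrite -tE => Q [].
have P_sumE z : in_sector x M z -> 0 <= Im z ->
    P_sum w k D z = \sum_(Q <- t) P_term w k Q z.
  move=> zx v0; apply: fsum_seq => // Q QD /negP nt.
  apply: (P_term_eq0 _ _ _ w k _ _ zx v0 (ltW M0) QD).
  by rewrite tE.
rewrite P_sumE; last 2 first.
- by rewrite /in_sector /= subrr normr0 mulr0.
- by [].
set A := (X in within X _); set X : R[i]^o := (ratr x)%:C.
have FA : Filter (within A (nbhs X)) by exact: within_filter.
have AE : \forall z \near within A (nbhs X),
    \sum_(Q <- t) P_term w k Q z = P_g w k D z.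
  by rewrite near_withinE; apply: filterE => z [z_up zx]; rewrite P_gE // P_sumE // ltW.
apply: cvg_trans (near_eq_cvg AE) _.
apply: cvg_sum => Q Qt.
have Qx : qeval Q x != 0 by apply: (qeval_rat_neq0 _ nsq); apply: tD.
have term_cvg : (P_term w k Q y : R[i]^o) @[y --> nbhs X] --> (P_term w k Q X : R[i]^o).
  apply: cvg_P_term; rewrite ?qnum_real ?qeval_real qeval_ratr.
    by rewrite fmorph_eq0.
  by rewrite -[0]/((0 : R)%:C) (inj_eq (@complexI R)) fmorph_eq0.
apply: cvg_trans term_cvg; apply: cvg_app; exact: cvg_within.
Qed.

Lemma weak_quantum_modular_P_g_rat k D : (0 < D)%N ->
    ~ (exists m : nat, D = (m ^ 2)%N) -> ~~ odd k ->
  weak_quantum_modular (P_g_rat (R := R) k D) (2 * k + 2)%N.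
Proof.
move=> D0 nsq k_even g; rewrite det_mx2 => det1.
set p := g 0 0 in det1 *; set q := g 0 1 in det1 *.
set r := g 1 0 in det1 *; set s := g 1 1 in det1 *.
have [t t_uniq tE] := finite_set_uniq_seq _ (finite_opp_forms D p q r s nsq).
have tD Q : Q \in t -> forms_of_disc D Q.
  by move=> Qt; have [] : opp_forms D p q r s Q by rewrite tE.
(* The real roots of the forms whose leading coefficient changes sign; the continuation is the
   correction sum of [P_sum_mobius]. *)
exists (\bigcup_(Q in opp_forms D p q r s) [set y : R | qeval Q y = 0]).
  apply: bigcup_finite; first exact: finite_opp_forms.
  move=> Q [QD _]; have [a1 [a2 QE]] := qeval_factor D Q (0 : R) D0 (qfa_neq0 nsq QD) QD.
  apply: (@sub_finite_set _ _ [set a1; a2]); last by [].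
  move=> y /= /eqP; rewrite QE !mulf_eq0 intr_eq0 (negPf (qfa_neq0 nsq QD)) /= !subr_eq0.
  by case/orP => /eqP ->; [left|right].
exists (fun y => \sum_(Q <- t) (sgz (qfa Q))%:~R / (qeval Q y)%:C ^+ k.+1).
  move=> y ySg; apply: geometric_analytic_real_analytic.
  apply: geometric_analytic_sum => Q Qt.
  apply: (geometric_analytic_qeval D) (tD _ Qt) _ => //.
    exact: (qfa_neq0 nsq (tD _ Qt)).
  by apply: contra_notN ySg => /eqP Qy; exists Q => //; rewrite tE.
move=> x num den _ den0.
set X : R[i] := (ratr x : R)%:C.
have linX (m n : int) : m%:~R * X + n%:~R = ratr (m%:~R * x + n%:~R).
  by rewrite rmorphD rmorphM /= !ratr_int /X -ratrC.
have denX : r%:~R * X + s%:~R != 0 by rewrite linX fmorph_eq0.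
have numX : (ratr (num / den) : R)%:C = (p%:~R * X + q%:~R) / (r%:~R * X + s%:~R).
  by rewrite -ratrC !linX fmorph_div.
have XE Q : forms_of_disc D Q -> qnum Q X != 0.
  by move=> QD; rewrite qnum_real qeval_ratr fmorph_eq0; exact: (qeval_rat_neq0 x nsq QD).
(* The arc value 0 is an arbitrary choice: by [XE] no form vanishes at a rational point. *)
rewrite !(P_g_ratE 0) // numX -/X (P_sum_mobius k nsq det1 denX); last 3 first.
- by [].
- by exists x, 0; split => //; exact: in_sector_rat.
- by right=> Q [QD _]; exact: XE.
rewrite -exprnN -linX mulrA mulVf ?expf_neq0 // mul1r opprB addrC subrK.
rewrite (eq_fsbigl _ _ _ tE).
rewrite -(fsbig_seq _ (fun Q => (sgz (qfa Q))%:~R / qeval Q X ^+ k.+1) t_uniq).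
by apply: eq_bigr => Q _; rewrite /X qeval_real.
Qed.
End modular.

Theorem proposition1p3 (R : realType) (w : R) (D k : nat)
    (D_gt0 : (0 < D)%N) (D_disc : is_discriminant D)
    (D_nonsquare : ~ exists m : nat, D = (m ^ 2)%N)
    (k_even : ~~ odd k) :
  [/\ forall tau : R[i], upper_half_plane tau -> P_g w k D (tau + 1) = P_g w k D tau,
      forall tau : R[i], upper_half_plane tau ->
        w = 2^-1 \/
          (forall Q, forms_of_disc D Q -> qfb Q ^+ 2 < D%:Z ->
             ~ semicircle Q tau) ->
        P_g w k D (- 1 / tau) = tau ^+ (2 * k + 2) * (P_g w k D tau - q_g k D tau),
      forall x : rat, cusp_limit (P_g w k D) x (P_g_rat k D x)
    & weak_quantum_modular (P_g_rat (R := R) k D) (2 * k + 2)%N ].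
Proof.
have in_sector_up (z : R[i]) : upper_half_plane z ->
    exists (x : rat) (M : R), 0 <= M /\ in_sector x M z.
  move=> z_up; exists 0, (`|Re z| / Im z); split; first by rewrite divr_ge0 // ltW.
  by rewrite /in_sector rmorph0 subr0 divfK // gt_eqF.
split.
- move=> tau tau_up; have tau1_up : upper_half_plane (tau + 1).
    by move: tau_up; case: tau => u v; rewrite /upper_half_plane /= addr0.
  rewrite (P_gE w k D _ D_nonsquare tau_up).
  rewrite (P_gE w k D _ D_nonsquare tau1_up).
  (* A translation preserves the leading coefficient, so there is no correction. *)
  have opp0 : opp_forms D 1 1 0 1 = set0.
    apply/seteqP; split=> // Q [QD /=]; rewrite /qact /qfa /= oppr0 expr1n expr0n /=.
    by rewrite !(mulr0, mulr1, addr0) -expr2 ltNge sqr_ge0.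
  have nz : 0%:~R * tau + 1%:~R != 0 :> R[i] by rewrite mul0r add0r oner_neq0.
  have arc : w = 2^-1 \/ (forall Q, opp_forms D 1 1 0 1 Q -> qnum Q tau != 0).
    by rewrite opp0; right.
  have := P_sum_mobius k D_nonsquare (erefl : 1 * 1 - 1 * 0 = 1 :> int) nz
    (ltW tau_up) (in_sector_up _ tau_up) arc.
  by rewrite opp0 fsbig_set0 subr0 !mul1r mul0r add0r divr1 expr1n mul1r.
- move=> tau tau_up w_arc; have tau0 : tau != 0.
    by apply: contraTneq tau_up => ->; rewrite /upper_half_plane /= ltxx.
  have S_up : upper_half_plane (- 1 / tau).
    exact: upper_half_plane_opp_inv.
  rewrite (P_gE w k D _ D_nonsquare tau_up).
  rewrite (P_gE w k D _ D_nonsquare S_up).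
  (* Under inversion the leading coefficient becomes [c], and [a c < 0] amounts to [b^2 < D] because
     [b^2 - D = 4 a c]. *)
  have oppE : opp_forms D 0 (-1) 1 0 = forms_of_disc D `&` [set Q | qfb Q ^+ 2 < D%:Z].
    have aE Q : qfa (qact 0 (- -1) (- 1) 0 Q) = qfc Q.
      by rewrite /qact /qfa /qfb /qfc /=; ring.
    apply/seteqP; split=> Q [QD /=]; rewrite ?aE => neg; split => //=; rewrite ?aE;
      by move: neg; rewrite -QD /qdisc; lra.
  have nz : 1%:~R * tau + 0%:~R != 0 :> R[i] by rewrite mul1r addr0.
  have arc : w = 2^-1 \/ (forall Q, opp_forms D 0 (-1) 1 0 Q -> qnum Q tau != 0).
    case: w_arc => [|arc]; [by left|right=> Q; rewrite oppE => -[QD QbD]].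
    apply/eqP => n0; apply: (arc Q QD QbD); split=> //.
    by rewrite /qtau -/(qnum Q tau) n0 mul0r.
  have := P_sum_mobius k D_nonsquare (erefl : 0 * 0 - (-1) * 1 = 1 :> int) nz
    (ltW tau_up) (in_sector_up _ tau_up) arc.
  rewrite oppE mul0r add0r mul1r addr0 => ->.
  congr (_ * (_ - _)); apply: eq_fsbigr => Q; rewrite inE => -[QD _].
  by rewrite (qsgnE _ _ D_nonsquare QD).
- by move=> x; exact: cusp_limit_P_g.
- exact: weak_quantum_modular_P_g_rat.
Qed.
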